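(* Let $(P,A,\lambda)$ be a marked poset with $|P|=n$ and marked elements $A=\{p_1,\dots,p_k\}$ labeled so that $\lambda_1\ge\cdots\ge\lambda_k$, where $\lambda_i=\lambda(p_i)$, and so that $p_i>p_j$ in $P$ implies $i<j$. Then $$\mathrm{Vol}\,\widetilde{\mathcal{O}}(P,A)_\lambda=\sum_{a_1,\dots,a_{k-1}\ge0}N_{P,A,\lambda}(a_1,\dots,a_{k-1})\,\frac{(\lambda_1-\lambda_2)^{a_1}}{a_1!}\cdots\frac{(\lambda_{k-1}-\lambda_k)^{a_{k-1}}}{a_{k-1}!}.$$
   Context: A marked poset $(P,A,\lambda)$ consists of a finite poset $P$, a subposet $A\subseteq P$ containing all minimal and all maximal elements of $P$, and an order-preserving map $\lambda:A\to\mathbb{R}$. Its marked order polytope is $\mathcal{O}(P,A)_\lambda=\{x\in\mathbb{R}^P: x_p\le x_q\text{ whenever }p<q\text{ in }P,\ x_a=\lambda(a)\text{ for }a\in A\}$, and $\widetilde{\mathcal{O}}(P,A)_\lambda$ is its projection onto the coordinates indexed by $P\setminus A$; $\mathrm{Vol}$ denotes $|P\setminus A|$-dimensional Euclidean volume in $\mathbb{R}^{P\setminus A}$. A linear extension of $P$ is an order-reversing bijection $\sigma:[n]\to P$ (i.e. $p<q$ in $P$ implies $\sigma^{-1}(p)>\sigma^{-1}(q)$; so $\sigma(1)$ is maximal). $N_{P,A,\lambda}(a_1,\dots,a_{k-1})$ is the number of linear extensions $\sigma$ of $P$ such that $\sigma(j+a_1+\cdots+a_{j-1})=p_j$ for every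 $j\in[k]$ (i.e. $p_1,\dots,p_k$ occur at positions $1,\,2+a_1,\,\dots,\,k+a_1+\cdots+a_{k-1}$). *)

(* Defs.v *)
From Stdlib Require Import Reals.
From HB Require Import structures.
From mathcomp Require Import all_boot.
From Stdlib Require List.

Set Implicit Arguments.
Unset Strict Implicit.
Unset Printing Implicit Defensive.

Local Open Scope R_scope.

Definition cube (I : finType) (N : nat) (z : {ffun I -> Z}) (y : {ffun I -> R}) : Prop :=
  forall i, (IZR (z i) / INR N <= y i <= (IZR (z i) + 1) / INR N).

(* [jordan_content S V]: S is Jordan measurable with Jordan content
   (|I|-dimensional volume) V: for all fine enough grids, the cubes inside S
   and the cubes meeting S both have total volume within eps of V. *)
Definition jordan_content (I : finType) (S : {ffun I -> R} -> Prop) (V : R) : Prop :=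
  forall eps : R, (0 < eps) ->
  exists N0 : nat, forall N : nat, (N0 <= N)%N -> (0 < N)%N ->
  exists Lin Lout : list {ffun I -> Z},
    List.NoDup Lin /\ List.NoDup Lout /\
    (forall z, List.In z Lin -> forall y, cube N z y -> S y) /\
    (forall z, (exists y, cube N z y /\ S y) -> List.In z Lout) /\
    (V - eps <= INR (List.length Lin) / (INR N ^ #|I|)) /\
    (INR (List.length Lout) / (INR N ^ #|I|) <= V + eps).

Definition is_partial_order (P : finType) (ord : rel P) : Prop :=
  reflexive ord /\ antisymmetric ord /\ transitive ord.

Definition poset_lt (P : finType) (ord : rel P) (x y : P) : bool := ord x y && (x != y).

(* marked elements p_1, ..., p_k  (k = K.+1, indices 0..K) *)
Definition marked_set (P : finType) (K : nat) (p : 'I_K.+1 -> P) : {set P} :=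
  [set p i | i : 'I_K.+1].

Definition free_coords (P : finType) (A : {set P}) : finType := {q : P | q \notin A}.

(* projection onto R^{P\A} of the marked order polytope O(P,A)_lambda *)
Definition Otilde (P : finType) (ord : rel P) (K : nat) (p : 'I_K.+1 -> P)
    (lam : 'I_K.+1 -> R) (y : {ffun free_coords (marked_set p) -> R}) : Prop :=
  exists x : P -> R,
    (forall i, x (p i) = lam i) /\
    (forall q (h : q \notin marked_set p), x q = y (exist _ q h)) /\
    (forall q r, poset_lt ord q r -> (x q <= x r)).

Arguments Otilde {P} ord {K} p lam y.

(* linear extension: order-reversing bijection sigma : [n] -> P
   (positions 1..n are represented 0-based by 'I_n) *)
Definition is_linext (P : finType) (ord : rel P) (sigma : {ffun 'I_#|P| -> P}) : bool :=
  [&& injectiveb sigma, [forall q, exists s, sigma s == q]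
    & [forall s, forall t, poset_lt ord (sigma s) (sigma t) ==> (t < s)%N]].

(* N_{P,A,lambda}(a_1,...,a_{k-1}): number of linear extensions with
   p_j at position j + a_1 + ... + a_{j-1} (here 0-based: j + sum_{i<j} a_i) *)
Definition Ncount (P : finType) (ord : rel P) (K : nat) (p : 'I_K.+1 -> P)
    (a : 'I_K -> nat) : nat :=
  #|[set sigma : {ffun 'I_#|P| -> P} | is_linext ord sigma &&
      [forall j : 'I_K.+1, exists s : 'I_#|P|,
          (val s == (j + \sum_(i < K | (i < j)%N) a i)%N) && (sigma s == p j)]]|.

(* right-hand side; a ranges over {0..n}^{k-1}, outside of which N vanishes *)
Definition rhs_sum (P : finType) (ord : rel P) (K : nat) (p : 'I_K.+1 -> P)
    (lam : 'I_K.+1 -> R) : R :=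
  \big[Rplus/0]_(a : {ffun 'I_K -> 'I_#|P|.+1})
     (INR (Ncount ord p (fun i => val (a i))) *
      \big[Rmult/1]_(i < K)
         ((lam (inord i) - lam (inord i.+1)) ^ (a i) / INR (a i)`!%N)).

(* Main.v *)
Require Import Defs.
From Stdlib Require Import Reals Lra Lia ZArith Classical.
From HB Require Import structures.
From mathcomp Require Import all_boot.
From mathcomp Require Import zify.

Set Implicit Arguments.
Unset Strict Implicit.
Unset Printing Implicit Defensive.

(** The volume is computed by counting grid cubes of side [1/N].  Sort the integer
    corners of a cube together with the marked values: between [lam i.+1] and
    [lam i] there are about [N (lam i - lam i.+1)] available integers, so injective
    order-respecting choices of corners are order-reversing placements of [P] in a
    chain in which [p i] and [p i.+1] are separated by [M i] free slots.  Such a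
    placement amounts to the sets of occupied slots, of sizes [a i], and the relative
    order of its values, a linear extension counted by [Ncount a]; hence their number is
    [\sum_a Ncount a * \prod_i 'C(M i, a i)], and [C(M i, a i) / N ^ a i] tends to
    [(lam i - lam i.+1) ^ a i / (a i)!].  With [M i] slightly smaller than the number
    of available integers every placement gives a cube inside the polytope.  With
    [M i] enlarged by a constant, every cube meeting the polytope arises: sort the
    coordinates of a common point and move the [s]-th corner by [2 s], which
    separates corners that are equal or out of order by 1. *)

(** * Linear extensions as position functions *)

(** The bijection is inversion of functions; [x0] and [y0] are the default values for building
    inverses with [pick]. *)
Lemma card_inverse_ffun (X Y : finType) (y0 : Y) (x0 : X)
    (S : {set {ffun X -> Y}}) (T : {set {ffun Y -> X}}) :
  (forall s, s \in S -> forall y, exists x, s x = y) ->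
  (forall s, s \in S -> injective s) ->
  (forall g, g \in T -> forall x, exists y, g y = x) ->
  (forall g, g \in T -> injective g) ->
  (forall (s : {ffun X -> Y}) (g : {ffun Y -> X}),
     cancel s g -> cancel g s -> (s \in S) = (g \in T)) ->
  #|S| = #|T|.
Proof.
move=> surjS injS surjT injT H.
have invP (U V : finType) (u0 : U) (s : {ffun U -> V}) :
    (forall v, exists u, s u = v) -> injective s ->
    let g := [ffun v => odflt u0 [pick u | s u == v]] in
    cancel s g /\ cancel g s.
  move=> surj inj g.
  have gK : cancel g s.
    move=> v; rewrite ffunE; case: pickP => [u /eqP //|/= no].
    by have [u /eqP] := surj v; rewrite no.
  by split => // u; apply: inj; rewrite gK.
pose phi (s : {ffun X -> Y}) := [ffun y => odflt x0 [pick x | s x == y]].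
rewrite -(@card_in_imset _ _ phi (mem S)).
  apply: eq_card => g; apply/imsetP/idP => [[s sS ->]|gT].
    have [sK gK] := invP _ _ x0 s (surjS s sS) (injS s sS).
    by rewrite -(H s).
  have [sK gK] := invP _ _ y0 g (surjT g gT) (injT g gT).
  set s := [ffun x => odflt y0 [pick y | g y == x]] in sK gK.
  have sS : s \in S by rewrite (H s g).
  exists s => //; apply/ffunP => y; apply: (can_inj gK).
  have [sK' gK'] := invP _ _ x0 s (surjS s sS) (injS s sS).
  by rewrite sK; rewrite -[LHS](gK' y).
move=> s1 s2 s1S s2S eq_phi; apply/ffunP => x.
have [sK1 gK1] := invP _ _ x0 s1 (surjS s1 s1S) (injS s1 s1S).
have [sK2 gK2] := invP _ _ x0 s2 (surjS s2 s2S) (injS s2 s2S).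
by rewrite -[s1 x]gK2 -/(phi s2) -eq_phi sK1.
Qed.

(** Linear extensions inverted: [g q] is the position of [q]. Ranks of occupied slots arise in this
    form. *)
Definition positions (P : finType) (ord : rel P) (K : nat) (p : 'I_K.+1 -> P)
    (a : 'I_K -> nat) : {set {ffun P -> 'I_#|P|}} :=
  [set g : {ffun P -> 'I_#|P|} |
     [&& injectiveb g,
         [forall q, forall r, poset_lt ord q r ==> (g r < g q)%N] &
         [forall j, val (g (p j)) == (j + \sum_(i < K | (i < j)%N) a i)%N]]].

Lemma inj_surj (X Y : finType) (s : X -> Y) :
  #|X| = #|Y| -> injective s -> forall y, exists x, s x = y.
Proof.
move=> eqXY inj y.
have [|g sK gK] := inj_card_bij inj; first by rewrite eqXY.
by exists (g y).
Qed.

Lemma Ncount_positions (P : finType) (ord : rel P) (K : nat)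
    (p : 'I_K.+1 -> P) (a : 'I_K -> nat) :
  Ncount ord p a = #|positions ord p a|.
Proof.
have n0 : (0 < #|P|)%N by apply/card_gt0P; exists (p ord0).
apply: (@card_inverse_ffun _ _ (p ord0) (Ordinal n0)).
- move=> s; rewrite inE => /andP[/and3P[_ /forallP su _] _] y.
  by have /existsP[x /eqP <-] := su y; exists x.
- by move=> s; rewrite inE => /andP[/and3P[/injectiveP]].
- move=> g; rewrite inE => /and3P[/injectiveP inj _ _].
  by apply: inj_surj => //; rewrite card_ord.
- by move=> g; rewrite inE => /and3P[/injectiveP].
move=> s g sK gK; rewrite !inE /is_linext.
have -> : injectiveb s by apply/injectiveP; apply: can_inj sK.
have -> : injectiveb g by apply/injectiveP; apply: can_inj gK.
have -> : [forall q, exists s0, s s0 == q].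
  by apply/forallP => q; apply/existsP; exists (g q); rewrite gK.
rewrite /=; congr andb.
  apply/forallP/forallP => H x; apply/forallP => y.
    by have /forallP/(_ (g y)) := H (g x); rewrite !gK.
  by have /forallP/(_ (s y)) := H (s x); rewrite !sK.
apply: eq_forallb => j; apply/existsP/idP => [[x /andP[/eqP xj /eqP <-]]|/eqP gj].
  by rewrite sK -xj.
by exists (g (p j)); rewrite gj gK !eqxx.
Qed.

(** Nothing lies below the element in the last position, so it is marked, and no marked position
    exceeds that of [p ord_max]. Hence [K + \sum a i] is the last position, which fixes the sum of
    the [a i]. *)
Lemma positions_size (P : finType) (ord : rel P) (K : nat)
    (p : 'I_K.+1 -> P) (a : 'I_K -> nat) g :
  (forall q : P, (forall r, ord r q -> r = q) -> q \in marked_set p) ->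
  g \in positions ord p a -> (K + \sum_(i < K) a i).+1 = #|P|.
Proof.
move=> Hmin; rewrite inE => /and3P[/injectiveP inj /forallP anti /forallP pos].
have n0 : (0 < #|P|)%N by apply/card_gt0P; exists (p ord0).
have ltn : (#|P|.-1 < #|P|)%N by rewrite prednK.
have [q gq] := @inj_surj _ _ g (esym (card_ord _)) inj (Ordinal ltn).
have qA : q \in marked_set p.
  apply: Hmin => r rq; apply/eqP/negPn/negP => neq.
  have := forallP (anti r) q; rewrite /poset_lt rq neq /= gq /=.
  by rewrite prednK // leqNgt ltn_ord.
case/imsetP: qA => j _ qj; have /eqP pj := pos j.
have /eqP pK := pos ord_max.
have eK : \sum_(i < K | (i < (ord_max : 'I_K.+1))%N) a i = \sum_(i < K) a i.
  by apply: eq_bigl => i; rewrite /= ltn_ord.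
have le_j : (\sum_(i < K | (i < j)%N) a i <= \sum_(i < K) a i)%N.
  by rewrite [leqRHS](bigID (fun i : 'I_K => (i < j)%N)) /= leq_addr.
rewrite eK /= in pK; rewrite -qj gq /= in pj.
have gK_lt := ltn_ord (g (p ord_max)); rewrite pK in gK_lt.
apply/eqP; rewrite eqn_leq gK_lt -(prednK n0) ltnS pj leq_add //.
by rewrite -ltnS ltn_ord.
Qed.

(** * Ranks in a strict total order *)

Definition rank (T : finType) (lt : rel T) (B : {set T}) (u : T) : nat :=
  #|[set v in B | lt v u]|.

Definition strict_total (T : finType) (lt : rel T) : Prop :=
  [/\ irreflexive lt, transitive lt & forall x y, x != y -> lt x y || lt y x].

Lemma rank_mono (T : finType) (lt : rel T) (B : {set T}) u v :
  strict_total lt -> u \in B -> lt u v -> (rank lt B u < rank lt B v)%N.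
Proof.
case=> irr trans _ uB uv; apply: proper_card; apply/properP; split.
  by apply/subsetP => w; rewrite !inE => /andP[-> wu]; apply: trans wu uv.
by exists u; rewrite !inE ?uB ?uv ?irr.
Qed.

Lemma rank_lt_inv (T : finType) (lt : rel T) (B : {set T}) u v :
  strict_total lt -> v \in B -> (rank lt B u < rank lt B v)%N -> lt u v.
Proof.
move=> st vB lt_uv; have [irr _ tot] := st.
have neq : u != v by apply: contraTneq lt_uv => ->; rewrite ltnn.
case/orP: (tot _ _ neq) => // /(rank_mono st vB) /(ltn_trans lt_uv).
by rewrite ltnn.
Qed.

Lemma rank_inj (T : finType) (lt : rel T) (B : {set T}) :
  strict_total lt -> {in B &, injective (rank lt B)}.
Proof.
move=> st u v uB vB eq_uv; have [_ _ tot] := st.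
apply/eqP/negPn/negP => /tot /orP[uv|vu].
  by have := rank_mono st uB uv; rewrite eq_uv ltnn.
by have := rank_mono st vB vu; rewrite eq_uv ltnn.
Qed.

Lemma rank_bound (T : finType) (lt : rel T) (B : {set T}) u :
  irreflexive lt -> u \in B -> (rank lt B u < #|B|)%N.
Proof.
move=> irr uB; apply: proper_card; apply/properP; split.
  by apply/subsetP => v; rewrite inE => /andP[].
by exists u; rewrite ?inE ?irr ?andbF.
Qed.

(** On [B] the rank is an injection into ['I_#|B|], hence onto by counting. *)
Lemma rank_surj (T : finType) (lt : rel T) (B : {set T}) s :
  strict_total lt -> (s < #|B|)%N -> exists2 u, u \in B & rank lt B u = s.
Proof.
move=> st sB; have [irr _ _] := st.
pose h (u : T) : 'I_#|B| := insubd (Ordinal sB) (rank lt B u).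
have hE u : u \in B -> h u = rank lt B u :> nat.
  by move=> uB; rewrite val_insubd rank_bound.
have h_inj : {in B &, injective h}.
  move=> u v uB vB /(congr1 val) /=; rewrite !hE //; exact: rank_inj.
have /setP/(_ (Ordinal sB)) : h @: B = setT.
  by apply/eqP; rewrite eqEcard subsetT cardsT card_ord card_in_imset /=.
rewrite inE => /imsetP[u uB us]; exists u => //.
by rewrite -hE // -us.
Qed.

Lemma rank_imset (P T : finType) (lt : rel T) (f : P -> T) (u : T) :
  injective f -> rank lt (f @: P) u = #|[set r | lt (f r) u]|.
Proof.
move=> inj; rewrite -(card_imset _ inj); apply: eq_card => v.
rewrite !inE; apply/andP/imsetP => [[/imsetP[r _ ->] lr]|[r]].
  by exists r => //; rewrite inE.
by rewrite inE => lr ->; rewrite imset_f.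
Qed.

(** * Slots and placements *)

(** Lexicographic order on pairs of a block and an offset, read from high values down: a later slot
    stands for a smaller coordinate. *)
Definition slot_lt (K m : nat) : rel ('I_K.+1 * 'I_m.+1) :=
  fun u v => (u.1 < v.1)%N || (u.1 == v.1) && (u.2 < v.2)%N.

Lemma slot_lt_total (K m : nat) : strict_total (@slot_lt K m).
Proof.
rewrite /slot_lt; split.
- by move=> u; rewrite ltnn eqxx ltnn.
- move=> [i s] [i' s'] [i'' s''] /=; rewrite -!val_eqE /=; lia.
move=> [i s] [i' s']; rewrite xpair_eqE -!val_eqE /=; lia.
Qed.

Lemma slot_lt_mark (K m : nat) (u : 'I_K.+1 * 'I_m.+1) (j : 'I_K.+1) :
  slot_lt u (j, ord0) = (u.1 < j)%N.
Proof. by rewrite /slot_lt /= andbF orbF. Qed.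

(* The slot [(j, 0)] is reserved for [p j], and [(i, s)] with [0 < s <= M i]
   are the [M i] places available strictly between [p i] and [p i.+1]. *)
Definition placements (P : finType) (ord : rel P) (K : nat) (p : 'I_K.+1 -> P)
    (m : nat) (M : nat -> nat) : {set {ffun P -> 'I_K.+1 * 'I_m.+1}} :=
  [set f : {ffun P -> 'I_K.+1 * 'I_m.+1} |
    [&& injectiveb f,
        [forall q, forall r, poset_lt ord q r ==> slot_lt (f r) (f q)],
        [forall j, f (p j) == (j, ord0)] &
        [forall q, (q \notin marked_set p) ==> (0 < (f q).2 <= M (f q).1)%N]]].

Lemma placementsP (P : finType) (ord : rel P) (K : nat) (p : 'I_K.+1 -> P)
    (m : nat) (M : nat -> nat) (f : {ffun P -> 'I_K.+1 * 'I_m.+1}) :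
  reflect [/\ injective f,
              forall q r, poset_lt ord q r -> slot_lt (f r) (f q),
              forall j, f (p j) = (j, ord0) &
              forall q, q \notin marked_set p -> (0 < (f q).2 <= M (f q).1)%N]
          (f \in placements ord p m M).
Proof.
rewrite inE; apply: (iffP and4P) => [[/injectiveP inj anti mark free]|[inj anti mark free]].
  split=> // [q r|j|q].
  - exact: implyP (forallP (forallP anti q) r).
  - exact/eqP/(forallP mark).
  - exact: implyP (forallP free q).
split; first exact/injectiveP.
- by apply/forallP => q; apply/forallP => r; apply/implyP/anti.
- by apply/forallP => j; rewrite mark.
- by apply/forallP => q; apply/implyP/free.
Qed.

(** Choose [s] below [q] with the smallest down-set. Any [r] below [s] has a down-set inside that of
    [s] and at least as large, so the two agree and [s] is below [r]. *)
Lemma minimal_below (P : finType) (ord : rel P) q :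
  is_partial_order ord -> exists2 s, ord s q & forall r, ord r s -> r = s.
Proof.
case=> refl [anti trans].
have [s sq smin] := @arg_minnP _ q (ord^~ q) (fun s => #|[set r | ord r s]|) (refl q).
exists s => // r rs; apply: (anti); rewrite rs /=.
have := smin r (trans _ _ _ rs sq) => le_sr.
have sub : [set t | ord t r] \subset [set t | ord t s].
  by apply/subsetP => t; rewrite !inE => tr; apply: trans tr rs.
have /setP/(_ s) : [set t | ord t r] = [set t | ord t s].
  by apply/eqP; rewrite eqEcard sub le_sr.
by rewrite !inE refl.
Qed.

Lemma marked_below (P : finType) (ord : rel P) (K : nat) (p : 'I_K.+1 -> P) q :
  is_partial_order ord ->
  (forall q : P, (forall r, ord r q -> r = q) -> q \in marked_set p) ->
  exists j, ord (p j) q.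
Proof.
move=> Hpo Hmin; have [s sq /Hmin/imsetP[j _ sj]] := minimal_below q Hpo.
by exists j; rewrite -sj.
Qed.

Lemma marked_above (P : finType) (ord : rel P) (K : nat) (p : 'I_K.+1 -> P) q :
  is_partial_order ord ->
  (forall q : P, (forall r, ord q r -> r = q) -> q \in marked_set p) ->
  exists j, ord q (p j).
Proof.
case=> refl [anti trans] Hmax.
apply: (@marked_below _ (fun x y => ord y x)) => //; split=> //; split.
  by move=> x y; rewrite andbC; apply: anti.
by move=> y x z xy yz; apply: trans yz xy.
Qed.

(** Some [p j] lies strictly below [q], so the slot of [q] precedes [(j, ord0)] and its block is
    smaller than [j]. Thus free elements occupy only the [K] blocks between consecutive marks. *)
Lemma free_block (P : finType) (ord : rel P) (K : nat) (p : 'I_K.+1 -> P)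
    (m : nat) (M : nat -> nat) f q :
  is_partial_order ord ->
  (forall q : P, (forall r, ord r q -> r = q) -> q \in marked_set p) ->
  f \in placements ord p m M -> q \notin marked_set p -> ((f q).1 < K)%N.
Proof.
move=> Hpo Hmin /placementsP[_ anti mark _] qA.
have [j jq] := marked_below q Hpo Hmin.
have := anti (p j) q; rewrite /poset_lt jq mark slot_lt_mark => /(_ _) lt_j.
apply: leq_trans (lt_j _) _; last by rewrite -ltnS ltn_ord.
by apply: contraNneq qA => <-; rewrite imset_f.
Qed.

(** * Counting placements by occupied slots and relative order *)

Section Decomposition.

Variables (P : finType) (ord : rel P) (K : nat) (p : 'I_K.+1 -> P).
Variables (m : nat) (M : nat -> nat).
Hypothesis Hpo : is_partial_order ord.
Hypothesis Hmin : forall q : P, (forall r, ord r q -> r = q) -> q \in marked_set p.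

Local Notation slot := ('I_K.+1 * 'I_m.+1)%type.
Local Notation blocks := {ffun 'I_K -> {set 'I_m.+1}}.

(** The [K.+1] reserved slots together with the slots that [D] selects; the last block has no [D i]
    and holds its reserved slot alone. *)
Definition used_slots (D : blocks) : {set slot} :=
  [set u : slot | (u.2 == ord0) || [exists i : 'I_K, (i == u.1 :> nat) && (u.2 \in D i)]].

Lemma used_slots_widen (D : blocks) i s :
  ((widen_ord (leqnSn K) i, s) \in used_slots D) = (s == ord0) || (s \in D i).
Proof.
rewrite inE /=; congr orb; apply/existsP/idP => [[i' /andP[/eqP ii']]|si].
  by rewrite (val_inj ii' : i' = i).
by exists i; rewrite eqxx.
Qed.

Lemma used_slots_max (D : blocks) s : ((ord_max, s) \in used_slots D) = (s == ord0).
Proof.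
rewrite inE /=; case: eqP => //= _; apply/existsP => -[i /andP[/eqP iK]].
by have := ltn_ord i; rewrite iK ltnn.
Qed.

Lemma card_used_slots (D : blocks) (j : nat) :
  (forall i, ord0 \notin D i) -> (j <= K.+1)%N ->
  #|[set u in used_slots D | (u.1 < j)%N]| = (j + \sum_(i < K | (i < j)%N) #|D i|)%N.
Proof.
move=> D0 jK; rewrite -sum1dep_card big_mkcond /=.
transitivity (\sum_i \sum_s
    (if ((i, s) \in used_slots D) && (i < j)%N then 1 else 0))%N.
  by rewrite pair_bigA; apply: eq_bigr => -[].
have lines i : \sum_s (if ((i, s) \in used_slots D) && (i < j)%N then 1 else 0)%N =
    (if (i < j)%N then #|[set s | (i, s) \in used_slots D]| else 0)%N.
  case: ltnP => _; last by rewrite big1 // => s _; rewrite andbF.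
  by rewrite -sum1dep_card [RHS]big_mkcond /=; apply: eq_bigr => s _; rewrite andbT.
rewrite (eq_bigr _ (fun i _ => lines i)) big_ord_recr /=.
have -> : [set s | (ord_max, s) \in used_slots D] = [set ord0].
  by apply/setP => s; rewrite in_set used_slots_max in_set1.
rewrite cards1.
have -> : \sum_(i < K) (if (i < j)%N then
     #|[set s | (widen_ord (leqnSn K) i, s) \in used_slots D]| else 0)%N =
   (\sum_(i < K | (i < j)%N) 1 + \sum_(i < K | (i < j)%N) #|D i|)%N.
  rewrite -big_split [RHS]big_mkcond /=; apply: eq_bigr => i _; case: ifP => // _.
  transitivity #|ord0 |: D i|; last by rewrite cardsU1 D0.
  by apply: eq_card => s; rewrite in_set used_slots_widen !inE.
(* The last block was split off by [big_ord_recr]; its single slot supplies the missing unit when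
   [j = K.+1]. *)
have -> : (\sum_(i < K | (i < j)%N) 1 = minn j K)%N.
  transitivity (\sum_(i < minn j K) 1)%N; last by rewrite sum1_card card_ord.
  rewrite (big_ord_widen K (fun=> 1%N) (geq_minr j K)).
  by apply: eq_bigl => i; rewrite leq_min ltn_ord andbT.
case: ltnP => /=; lia.
Qed.

Lemma rank_ffun_bound (f : {ffun P -> slot}) q :
  (#|[set r | slot_lt (f r) (f q)]| < #|P|)%N.
Proof.
rewrite -cardsT; apply: proper_card; apply/properP; split; first exact: subsetT.
by exists q; rewrite ?inE // /slot_lt !ltnn andbF.
Qed.

Definition block_ffun (f : {ffun P -> slot}) : blocks :=
  [ffun i => [set s | (s != ord0) && [exists q, f q == (widen_ord (leqnSn K) i, s)]]].

Definition rank_ffun (f : {ffun P -> slot}) : {ffun P -> 'I_#|P|} :=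
  [ffun q => Ordinal (rank_ffun_bound f q)].

Definition decompositions : {set blocks * {ffun P -> 'I_#|P|}} :=
  [set Dg : blocks * {ffun P -> 'I_#|P|} |
    [forall i, Dg.1 i \subset [set s : 'I_m.+1 | (0 < s <= M i)%N]] &&
    (Dg.2 \in positions ord p (fun i => #|Dg.1 i|))].

Lemma used_slots_block_ffun f :
  f \in placements ord p m M -> f @: P = used_slots (block_ffun f).
Proof.
move=> fp; have /placementsP[inj anti mark free] := fp.
apply/setP => -[j s].
case: (unliftP ord_max j) => [i ->|->]; last first.
  (* In the last block a free element is excluded by [free_block], so only [p ord_max] remains. *)
  rewrite used_slots_max; apply/imsetP/eqP => [[q _ fq]|->]; last first.
    by exists (p ord_max); rewrite ?mark.
  have [/imsetP[i _ qi]|/(free_block Hpo Hmin fp)] := boolP (q \in marked_set p).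
    by move: fq; rewrite qi mark => -[].
  by rewrite -fq /= ltnn.
have -> : lift ord_max i = widen_ord (leqnSn K) i.
  by apply: val_inj; rewrite /= /bump leqNgt ltn_ord.
rewrite used_slots_widen ffunE inE.
case: eqP => [->|_] /=.
  by apply/imsetP; exists (p (widen_ord (leqnSn K) i)); rewrite ?mark.
by apply/imsetP/existsP => [[q _ ->]|[q /eqP <-]]; exists q.
Qed.

Lemma rank_ffunE f q : f \in placements ord p m M ->
  rank_ffun f q = rank (@slot_lt K m) (used_slots (block_ffun f)) (f q) :> nat.
Proof.
move=> fp; have /placementsP[inj _ _ _] := fp.
by rewrite ffunE /= -used_slots_block_ffun // rank_imset.
Qed.

Lemma used_slotsP f q : f \in placements ord p m M ->
  f q \in used_slots (block_ffun f).
Proof. by move=> fp; rewrite -used_slots_block_ffun // imset_f. Qed.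

Lemma rank_used_slots (D : blocks) (j : 'I_K.+1) :
  (forall i, ord0 \notin D i) ->
  rank (@slot_lt K m) (used_slots D) (j, ord0) =
  (j + \sum_(i < K | (i < j)%N) #|D i|)%N.
Proof.
move=> D0; rewrite -(card_used_slots D0) ?(ltnW (ltn_ord j)) //.
by apply: eq_card => u; rewrite in_set [in RHS]in_set slot_lt_mark.
Qed.

Lemma decomposition_mem f : f \in placements ord p m M ->
  (block_ffun f, rank_ffun f) \in decompositions.
Proof.
move=> fp; have /placementsP[inj anti mark free] := fp.
have D0 i : ord0 \notin block_ffun f i by rewrite ffunE inE eqxx.
rewrite inE /=; apply/andP; split.
  apply/forallP => i; apply/subsetP => s.
  rewrite ffunE !inE => /andP[s0 /existsP[q /eqP fq]].
  have qA : q \notin marked_set p.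
    by apply: contraNN s0 => /imsetP[j _ qj]; move: fq; rewrite qj mark => -[_ <-].
  by have := free q qA; rewrite fq.
have st := @slot_lt_total K m.
rewrite inE; apply/and3P; split.
- apply/injectiveP => q r eq_qr; apply: inj.
  apply: (rank_inj st (used_slotsP q fp) (used_slotsP r fp)).
  by rewrite -!rank_ffunE // eq_qr.
- apply/forallP => q; apply/forallP => r; apply/implyP => /anti fr.
  by rewrite !rank_ffunE //; apply: rank_mono => //; apply: used_slotsP.
by apply/forallP => j; rewrite /= rank_ffunE // mark rank_used_slots.
Qed.

(** The slot of [q] is recovered as the one of rank [rank_ffun f q] among the used slots. *)
Lemma decomposition_inj :
  {in placements ord p m M &, injective (fun f => (block_ffun f, rank_ffun f))}.
Proof.
move=> f f' fp fp' [eqD eqg]; apply/ffunP => q.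
apply: (rank_inj (@slot_lt_total K m) (used_slotsP q fp)).
  by rewrite eqD used_slotsP.
by rewrite -rank_ffunE // eqD -rank_ffunE // eqg.
Qed.

(** Send [q] to the used slot of rank [g q]. Such a slot exists because there are exactly [#|P|]
    used slots, by [positions_size]; the positions prescribed for the marks are the ranks of the
    reserved slots. *)
Lemma decomposition_surj D g : (D, g) \in decompositions ->
  exists2 f, f \in placements ord p m M & (D, g) = (block_ffun f, rank_ffun f).
Proof.
rewrite inE /= => /andP[/forallP DM gp].
have st := @slot_lt_total K m; have [irr _ _] := st.
have DMP i s : s \in D i -> (0 < s <= M i)%N.
  by move/(subsetP (DM i)); rewrite inE.
have D0 i : ord0 \notin D i by apply/negP => /DMP.
have cardB : #|used_slots D| = #|P|.
  rewrite -(positions_size Hmin gp) -[RHS]addSn.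
  have := card_used_slots D0 (leqnn K.+1).
  rewrite (eq_bigl xpredT) => [<-|i]; last by rewrite (ltn_trans (ltn_ord i)).

  by apply: eq_card => u; rewrite [RHS]in_set ltn_ord andbT.
have /and3P[/injectiveP g_inj /forallP g_anti /forallP g_mark] :
  [&& injectiveb g,
      [forall q, forall r, poset_lt ord q r ==> (g r < g q)%N] &
      [forall j, val (g (p j)) == (j + \sum_(i < K | (i < j)%N) #|D i|)%N]].
  by move: gp; rewrite inE.
pose f := [ffun q => odflt (ord0, ord0)
  [pick u in used_slots D | rank (@slot_lt K m) (used_slots D) u == g q]].
have fE q : f q \in used_slots D /\ rank (@slot_lt K m) (used_slots D) (f q) = g q.
  rewrite ffunE; case: pickP => [u /andP[uB /eqP ru]|no] /=; first by [].
  have gB : (g q < #|used_slots D|)%N by rewrite cardB.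
  have [u uB ru] := rank_surj st gB.
  by have := no u; rewrite uB ru eqxx.
have f_inj : injective f.
  move=> q r eq_qr; apply: g_inj; apply: val_inj.
  by rewrite /= -(fE q).2 -(fE r).2 eq_qr.
have fB : f @: P = used_slots D.
  apply/eqP; rewrite eqEcard card_imset // cardB leqnn andbT.
  by apply/subsetP => _ /imsetP[q _ ->]; case: (fE q).
have f_mark j : f (p j) = (j, ord0).
  have jB : (j, ord0) \in used_slots D by rewrite inE eqxx.
  apply: (rank_inj st (fE (p j)).1 jB).
  by rewrite (fE _).2 rank_used_slots //; apply/eqP/g_mark.
have fp : f \in placements ord p m M.
  apply/placementsP; split=> // [q r qr|q qA].
    apply: (rank_lt_inv st (fE q).1); rewrite (fE q).2 (fE r).2.
    exact: implyP (forallP (g_anti q) r) qr.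
  have := (fE q).1; rewrite inE => /orP[/eqP q2|/existsP[i /andP[/eqP <- /DMP //]]].
  case/negP: qA; apply/imsetP; exists (f q).1 => //; apply: f_inj.
  by rewrite f_mark -q2 -surjective_pairing.
exists f => //; congr pair.
  apply/ffunP => i; apply/setP => s; rewrite ffunE inE.
  transitivity ((s != ord0) && ((widen_ord (leqnSn K) i, s) \in used_slots D)).
    rewrite used_slots_widen; case: eqP => //= ->.
    exact/negbTE.
  congr andb; rewrite -fB.
  by apply/imsetP/existsP => [[q _ ->]|[q /eqP <-]]; exists q.
apply/ffunP => q; apply: val_inj.
by rewrite [in RHS]ffunE /= -(fE q).2 -fB rank_imset.
Qed.

Lemma card_decompositions : #|placements ord p m M| = #|decompositions|.
Proof.
rewrite -(card_in_imset decomposition_inj); apply: eq_card => -[D g].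
apply/imsetP/idP => [[f fp ->]|/decomposition_surj[f fp ->]].
  exact: decomposition_mem.
by exists f.
Qed.

(** The blocks are chosen independently, each as an [a i]-subset of the offsets from 1 to [M i]; the
    bound by [m] makes all these offsets available in ['I_m.+1]. *)
Lemma card_block_family (a : 'I_K -> nat) :
  (forall i : 'I_K, (M i <= m)%N) ->
  #|[set D : blocks | [forall i, D i \subset [set s : 'I_m.+1 | (0 < s <= M i)%N]] &&
                      [forall i, #|D i| == a i]]| = (\prod_(i < K) 'C(M i, a i))%N.
Proof.
move=> Mm.
pose F (i : 'I_K) := mem [set A : {set 'I_m.+1} |
  (A \subset [set s : 'I_m.+1 | (0 < s <= M i)%N]) && (#|A| == a i)].
transitivity #|family F|.
  apply: eq_card => D; rewrite inE; apply/andP/familyP => [[/forallP DM /forallP Da] i|H].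
    by rewrite /F !inE DM Da.
  by split; apply/forallP => i; have := H i; rewrite !inE => /andP[].
rewrite card_family foldrE big_map big_enum /=; apply: eq_bigr => i _.
rewrite /F cards_draws; congr 'C(_, _).
rewrite -sum1dep_card.
transitivity (\sum_(i0 < m.+1) ((0 < i0 <= M i)%N : nat))%N.
  by rewrite big_mkcond /=; apply: eq_bigr => s _; case: ifP.
rewrite big_ord_recl /= add0n.
transitivity (\sum_(s < m | (s < M i)%N) 1)%N.
  by rewrite [RHS]big_mkcond /=; apply: eq_bigr => s _; rewrite /bump /=; case: ifP => // ->.
by rewrite -(big_ord_widen m (fun=> 1%N) (Mm i)) sum1_card card_ord.
Qed.

Lemma Ncount_ext (a b : 'I_K -> nat) : a =1 b -> Ncount ord p a = Ncount ord p b.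
Proof.
move=> ab; rewrite !Ncount_positions; apply: eq_card => g; rewrite !inE.
congr [&& _, _ & _]; apply: eq_forallb => j; congr (_ == _ + _)%N.
by apply: eq_bigr => i _; rewrite ab.
Qed.

Lemma card_placements :
  (forall i : 'I_K, (M i <= m)%N) ->
  #|placements ord p m M| =
  (\sum_(a : {ffun 'I_K -> 'I_#|P|.+1})
     Ncount ord p (fun i => val (a i)) * \prod_(i < K) 'C(M i, a i))%N.
Proof.
move=> Mm; rewrite card_decompositions.
pose ok (D : blocks) := [forall i, D i \subset [set s : 'I_m.+1 | (0 < s <= M i)%N]].
have -> : #|decompositions| = \sum_(D | ok D) Ncount ord p (fun i => #|D i|).
  rewrite -sum1_card.
  rewrite (eq_bigl (fun Dg : blocks * _ => ok Dg.1 &&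
      (Dg.2 \in positions ord p (fun i => #|Dg.1 i|)))); last first.
    by move=> Dg; rewrite inE.
  rewrite -(pair_big_dep ok (fun D g => g \in positions ord p (fun i => #|(D : blocks) i|))
    (fun _ _ => 1%N)) /=.
  by apply: eq_bigr => D _; rewrite Ncount_positions sum1_card.
(* Each product of binomials is expanded into the block families it counts; after exchanging sums,
   [D] meets only the [a] that lists its block sizes. *)
under [RHS]eq_bigr => a _ do rewrite -(card_block_family (fun i => val (a i)) Mm)
  -sum1dep_card big_distrr big_mkcondr /=.
rewrite exchange_big /=; apply: eq_bigr => D _.
under eq_bigr => a _ do rewrite muln1.
rewrite -big_mkcond /=.
(* If a block of [D] has more than [#|P|] slots, no [a] in the range matches it, and by
   [positions_size] the left side is 0 as well. *)
have [/existsP[i]|/existsPn small] := boolP [exists i, (#|P| < #|D i|)%N].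
  move=> big; rewrite big1 => [|a /forallP/(_ i)/eqP ai]; last first.
    by have := ltn_ord (a i); rewrite -ai ltnS leqNgt big.
  rewrite Ncount_positions; apply: eq_card0 => g.
  apply/negP => /(positions_size Hmin) eqP'.
  move: big; rewrite -eqP' (bigD1 i) //=; lia.
rewrite (big_pred1 [ffun i => inord #|D i|]) => [|a].
  by apply: Ncount_ext => i; rewrite ffunE inordK // ltnS leqNgt small.
apply/forallP/eqP => [H|-> i].
  apply/ffunP => i; apply: val_inj.
  by rewrite ffunE /= (eqP (H i)) inordK -?(eqP (H i)) // ltnS leqNgt small.
by rewrite ffunE inordK // ltnS leqNgt small.
Qed.

End Decomposition.

Local Open Scope R_scope.

(** * Limits of normalized counts *)

Lemma Un_cv_ext (u v : nat -> R) l : u =1 v -> Un_cv u l -> Un_cv v l.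
Proof.
move=> uv cv eps /cv[N0 cvN]; exists N0 => n /cvN; by rewrite uv.
Qed.

Lemma Un_cv_cst c : Un_cv (fun=> c) c.
Proof. by move=> eps eps0; exists 0%N => n _; rewrite R_dist_eq. Qed.

Lemma Un_cv_sum (I : Type) (r : seq I) (F : nat -> I -> R) (l : I -> R) :
  (forall i, Un_cv (F^~ i) (l i)) ->
  Un_cv (fun N => \big[Rplus/0]_(i <- r) F N i) (\big[Rplus/0]_(i <- r) l i).
Proof.
move=> cv; elim: r => [|i r IH].
  by rewrite big_nil; apply: Un_cv_ext (Un_cv_cst 0) => N; rewrite big_nil.
rewrite big_cons.
by apply: Un_cv_ext (CV_plus _ _ _ _ (cv i) IH) => N; rewrite big_cons.
Qed.

Lemma Un_cv_prod (I : Type) (r : seq I) (F : nat -> I -> R) (l : I -> R) :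
  (forall i, Un_cv (F^~ i) (l i)) ->
  Un_cv (fun N => \big[Rmult/1]_(i <- r) F N i) (\big[Rmult/1]_(i <- r) l i).
Proof.
move=> cv; elim: r => [|i r IH].
  by rewrite big_nil; apply: Un_cv_ext (Un_cv_cst 1) => N; rewrite big_nil.
rewrite big_cons.
by apply: Un_cv_ext (CV_mult _ _ _ _ (cv i) IH) => N; rewrite big_cons.
Qed.

Lemma Un_cv_ratio (M : nat -> nat) (L C : R) :
  (forall N, - C <= INR (M N) - INR N * L <= C) ->
  Un_cv (fun N => INR (M N) / INR N) L.
Proof.
move=> MC eps eps0.
have C0 : 0 <= C by have := MC 0%N; lra.
have [N0 CN0] := INR_archimed eps (C + eps) eps0.
exists N0.+1 => n /leP n0.
have nN0 : INR N0 <= INR n by apply: le_INR; apply/leP; apply: leq_trans n0; apply: leqnSn.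
have pos : 0 < INR n by apply: lt_0_INR; apply/ltP; apply: leq_trans n0.
rewrite /R_dist (_ : INR (M n) / INR n - L = (INR (M n) - INR n * L) * / INR n); last by field; lra.
rewrite Rabs_mult Rabs_inv (Rabs_pos_eq (INR n)); last lra.
apply: (Rmult_lt_reg_r (INR n)) => //; rewrite Rmult_assoc Rinv_l ?Rmult_1_r; last lra.
apply: Rle_lt_trans (Rabs_le _ _ (MC n)) _; nra.
Qed.

(** Induction on [a] through [(a+1) C(M, a+1) = (M-a) C(M, a)]: the factor [M - a] stays within
    [C + a] of [N L]. *)
Lemma Un_cv_binomial (M : nat -> nat) (L C : R) (a : nat) :
  0 <= L -> (forall N, - C <= INR (M N) - INR N * L <= C) ->
  Un_cv (fun N => INR 'C(M N, a) / INR N ^ a) (L ^ a / INR a`!%N).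
Proof.
move=> L0 MC; elim: a => [|a IH].
  rewrite fact0 /=; apply: Un_cv_ext (_ : Un_cv (fun=> 1 / 1) _).
    by move=> N; rewrite bin0.
  exact: Un_cv_cst.
have cvM : Un_cv (fun N => INR (M N - a)%N / INR N) L.
  apply: (@Un_cv_ratio _ _ (C + INR a)) => N.
  have := MC N; have := pos_INR a; have := pos_INR N; move=> N0 a0.
  have NL : 0 <= INR N * L by apply: Rmult_le_pos.
  case: (leqP a (M N)) => [aM|Ma].
    rewrite minus_INR; last exact/leP.
    lra.
  (* The subtraction truncates here, but then [N L <= M N + C < a + C], so the error bound
     survives. *)
  have -> : (M N - a = 0)%N by apply/eqP; rewrite subn_eq0 ltnW.
  have := lt_INR _ _ (ltP Ma); have := pos_INR (M N).
  by rewrite /=; lra.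
have a1 : INR a.+1 <> 0 by apply: not_0_INR.
have fa : INR a`!%N <> 0 by apply: not_0_INR; apply/eqP; rewrite -lt0n fact_gt0.
have := CV_mult _ _ _ _ (CV_mult _ _ _ _ IH cvM) (Un_cv_cst (/ INR a.+1)).
have -> : L ^ a / INR a`!%N * L * / INR a.+1 = L ^ a.+1 / INR a.+1`!%N.
  by rewrite factS mult_INR [L ^ a.+1]/=; field.
apply: Un_cv_ext => N.
have : INR a.+1 * INR 'C(M N, a.+1) = INR (M N - a) * INR 'C(M N, a).
  by rewrite -!mult_INR; congr INR; apply: mul_bin_left.
move=> eqC; have -> : INR 'C(M N, a.+1) = INR (M N - a) * INR 'C(M N, a) / INR a.+1.
  by rewrite -eqC; field.
by rewrite [INR N ^ a.+1]/= /Rdiv Rinv_mult; ring.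
Qed.

Lemma INR_sum (I : Type) (r : seq I) (F : I -> nat) :
  INR (\sum_(i <- r) F i)%N = \big[Rplus/0]_(i <- r) INR (F i).
Proof. exact: (big_morph INR plus_INR). Qed.

Lemma INR_prod (I : Type) (r : seq I) (F : I -> nat) :
  INR (\prod_(i <- r) F i)%N = \big[Rmult/1]_(i <- r) INR (F i).
Proof. exact: (big_morph INR mult_INR). Qed.

Lemma prod_div_pow (I : Type) (r : seq I) (F : I -> R) (a : I -> nat) (x : R) :
  \big[Rmult/1]_(i <- r) (F i / x ^ a i) =
  (\big[Rmult/1]_(i <- r) F i) / x ^ (\sum_(i <- r) a i)%N.
Proof.
elim: r => [|i r IH]; first by rewrite !big_nil /=; field.
rewrite !big_cons IH -[(a i + _)%N]/(a i + _)%coq_nat pow_add /Rdiv Rinv_mult; ring.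
Qed.

Lemma card_free_coords (P : finType) (K : nat) (p : 'I_K.+1 -> P) :
  injective p -> (K.+1 + #|free_coords (marked_set p)|)%N = #|P|.
Proof.
move=> inj; rewrite /free_coords card_sig -(cardC (mem (marked_set p))).
by rewrite [#|mem (marked_set p)|]card_imset // card_ord.
Qed.

(** The limit is taken term by term in [card_placements]: the power of [N] splits over the blocks
    because the [a i] of a nonzero term sum to the dimension. *)
Lemma card_placements_limit (P : finType) (ord : rel P) (K : nat)
    (p : 'I_K.+1 -> P) (lam : 'I_K.+1 -> R)
    (m : nat -> nat) (M : nat -> nat -> nat) (C : R) :
  is_partial_order ord -> injective p ->
  (forall q : P, (forall r, ord r q -> r = q) -> q \in marked_set p) ->
  (forall i j : 'I_K.+1, (i <= j)%N -> lam j <= lam i) ->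
  (forall N (i : 'I_K), (M N i <= m N)%N) ->
  (forall N (i : 'I_K),
     - C <= INR (M N i) - INR N * (lam (inord i) - lam (inord i.+1)) <= C) ->
  Un_cv (fun N => INR #|placements ord p (m N) (M N)| /
                  INR N ^ #|free_coords (marked_set p)|)
        (rhs_sum ord p lam).
Proof.
move=> Hpo Hinj Hmin Hdec Mm MC.
have cv (a : {ffun 'I_K -> 'I_#|P|.+1}) :
    Un_cv (fun N => INR (Ncount ord p (fun i => val (a i))) *
       \big[Rmult/1]_(i < K) (INR 'C(M N i, a i) / INR N ^ a i))
      (INR (Ncount ord p (fun i => val (a i))) *
       \big[Rmult/1]_(i < K)
         ((lam (inord i) - lam (inord i.+1)) ^ (a i) / INR (a i)`!%N)).
  apply: CV_mult; first exact: Un_cv_cst.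
  apply: Un_cv_prod => i; apply: (Un_cv_binomial _ _ (MC^~ i)).
  have := Hdec (inord i) (inord i.+1); rewrite !inordK ?ltnS // => [/(_ (leqnSn i))|]; first lra.
  exact: ltnW.
apply: Un_cv_ext (Un_cv_sum _ cv) => N.
rewrite (card_placements Hpo Hmin (Mm N)) INR_sum.
rewrite (big_morph (fun x => x / INR N ^ #|free_coords (marked_set p)|) (op1 := Rplus)
  (id1 := 0)); [|by move=> x y; rewrite /Rdiv Rmult_plus_distr_r|by rewrite /Rdiv Rmult_0_l].
apply: eq_bigr => a _; rewrite mult_INR.
case: (posnP (Ncount ord p (fun i => val (a i)))) => [->|]; first by rewrite /Rdiv !Rmult_0_l.
rewrite {1}Ncount_positions => /card_gt0P[g /(positions_size Hmin)].
(* Both [K.+1 + \sum a i] and [K.+1] plus the number of free coordinates equal [#|P|]. *)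
rewrite -addSn => eqP; have /addnI <- := etrans eqP (esym (card_free_coords Hinj)).
by rewrite prod_div_pow INR_prod /Rdiv Rmult_assoc.
Qed.

(** * Integer parts, lists and grid cubes *)

Lemma Int_part_bounds (r : R) : IZR (Int_part r) <= r < IZR (Int_part r) + 1.
Proof. by have := base_Int_part r; lra. Qed.

Lemma le_Int_part (z : Z) (r : R) : IZR z <= r -> (z <= Int_part r)%Z.
Proof.
move=> zr; have rb := Int_part_bounds r.
suff : (z < Int_part r + 1)%Z by lia.
by apply: lt_IZR; rewrite plus_IZR; lra.
Qed.

Lemma Int_part_mono (r s : R) : r <= s -> (Int_part r <= Int_part s)%Z.
Proof. by move=> rs; apply: le_Int_part; have := Int_part_bounds r; lra. Qed.

Lemma NoDup_map_uniq (T : eqType) (U : Type) (h : T -> U) (s : seq T) :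
  uniq s -> {in s &, injective h} -> List.NoDup (List.map h s).
Proof.
elim: s => [|x s IH] /=; first by constructor.
case/andP=> xs us inj; constructor; last first.
  by apply: IH => // y z ys zs; apply: inj; rewrite inE ?ys ?zs orbT.
move=> /List.in_map_iff[y [hy ys]].
have {}ys : y \in s.
  by elim: s ys {IH xs us inj} => //= z s IH [->|/IH]; rewrite inE ?eqxx // => ->; rewrite orbT.
by move: xs; rewrite -(inj y x) // ?inE ?eqxx ?ys ?orbT.
Qed.

Lemma In_mem (T : eqType) (x : T) (s : seq T) : x \in s -> List.In x s.
Proof.
elim: s => //= y s IH; rewrite inE => /orP[/eqP ->|/IH]; by [left|right].
Qed.

Lemma mem_In (T : eqType) (x : T) (s : seq T) : List.In x s -> x \in s.
Proof.
by elim: s => //= y s IH [->|/IH xs]; rewrite inE ?eqxx // xs orbT.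
Qed.

(** Serves the outer cubes: distinct placements may decode to one cube, and only an upper bound on
    the number of cubes is wanted. *)
Lemma NoDup_subcover (T : Type) (l : list T) :
  exists l', List.NoDup l' /\ (forall x, List.In x l -> List.In x l') /\
             (List.length l' <= List.length l)%N.
Proof.
elim: l => [|x l [l' [nd [sub len]]]]; first by exists nil; split; first constructor.
case: (classic (List.In x l')) => xl'.
  exists l'; split=> //; split; last exact: leqW.
  by move=> y [<-|/sub].
exists (x :: l')%list; split; first by constructor.
by split=> // y [<-|/sub]; [left|right].
Qed.

Lemma cube_scale (I : finType) (N : nat) (z : {ffun I -> Z}) (y : {ffun I -> R}) i :
  (0 < N)%N -> cube N z y -> IZR (z i) <= INR N * y i <= IZR (z i) + 1.
Proof.
move=> N0 /(_ i); have Npos : 0 < INR N by apply: lt_0_INR; apply/ltP.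
have e c : c / INR N * INR N = c by field; lra.
case=> lo hi.
have := Rmult_le_compat_r (INR N) _ _ (Rlt_le _ _ Npos) lo.
have := Rmult_le_compat_r (INR N) _ _ (Rlt_le _ _ Npos) hi.
by rewrite !e; lra.
Qed.

(** If [j] is in [S], then [S] contains the [j.+1] indices up to [j]; otherwise it lies inside the
    [j] indices below [j]. *)
Lemma mem_downset (n : nat) (S : {set 'I_n}) (j : 'I_n) :
  (forall i k : 'I_n, (i <= k)%N -> k \in S -> i \in S) -> (j \in S) = (j < #|S|)%N.
Proof.
move=> down.
have card_lt (k : nat) : (k <= n)%N -> #|[set i : 'I_n | (i < k)%N]| = k.
  by move=> kn; rewrite -sum1dep_card -(big_ord_widen n (fun=> 1%N) kn) sum1_card card_ord.
apply/idP/idP => [jS|].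
  rewrite -{1}(card_lt j.+1 (ltn_ord j)); apply: subset_leq_card.
  by apply/subsetP => i; rewrite inE ltnS => /down; apply.
apply: contraLR => jS; rewrite -leqNgt -(card_lt j (ltnW (ltn_ord j))).
apply: subset_leq_card; apply/subsetP => i iS; rewrite inE ltnNge.
by apply: contra jS => ji; apply: down ji iS.
Qed.

(** * From placements to grid cubes *)

Section Cubes.

Variables (P : finType) (ord : rel P) (K : nat).
Variables (p : 'I_K.+1 -> P) (lam : 'I_K.+1 -> R).
Hypothesis Hpo : is_partial_order ord.
Hypothesis Hinj : injective p.
Hypothesis Hmin : forall q : P, (forall r, ord r q -> r = q) -> q \in marked_set p.
Hypothesis Hmax : forall q : P, (forall r, ord q r -> r = q) -> q \in marked_set p.
Hypothesis Hdec : forall i j : 'I_K.+1, (i <= j)%N -> lam j <= lam i.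

Local Notation free := (free_coords (marked_set p)).

Definition grid_floor (N : nat) (j : 'I_K.+1) : Z := Int_part (INR N * lam j).

Definition grid_gap (N : nat) (i : nat) : nat :=
  Z.to_nat (grid_floor N (inord i) - grid_floor N (inord i.+1)).

Lemma grid_floor_mono N (i j : 'I_K.+1) : (i <= j)%N -> (grid_floor N j <= grid_floor N i)%Z.
Proof.
move=> ij; apply: Int_part_mono; apply: Rmult_le_compat_l; first exact: pos_INR.
exact: Hdec.
Qed.

Lemma inord_le_succ (i : 'I_K) : ((inord i : 'I_K.+1) <= (inord i.+1 : 'I_K.+1))%N.
Proof. by rewrite !inordK ?ltnS //; apply: ltnW. Qed.

Lemma grid_gapE N (i : 'I_K) :
  Z.of_nat (grid_gap N i) = (grid_floor N (inord i) - grid_floor N (inord i.+1))%Z.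
Proof.
rewrite /grid_gap Z2Nat.id //.
by have := @grid_floor_mono N _ _ (inord_le_succ i); lia.
Qed.

Lemma grid_gap_bounds N (i : 'I_K) :
  -1 <= INR (grid_gap N i) - INR N * (lam (inord i) - lam (inord i.+1)) <= 1.
Proof.
rewrite INR_IZR_INZ grid_gapE minus_IZR /grid_floor.
have := Int_part_bounds (INR N * lam (inord i)).
by have := Int_part_bounds (INR N * lam (inord i.+1)); lra.
Qed.

(** All blocks share one width [m] of offsets; a sum is a convenient common bound for the gaps
    enlarged by [c]. *)
Definition gap_bound (N c : nat) : nat := (\sum_(i < K) grid_gap N i + c)%N.

Lemma gap_bound_ge N c (i : 'I_K) : (grid_gap N i + c <= gap_bound N c)%N.
Proof. by rewrite leq_add2r (bigD1 i) //= leq_addr. Qed.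

Definition elt (u : free) : P := val u.

Lemma eltP (u : free) : elt u \notin marked_set p.
Proof. exact: (valP u). Qed.

Lemma insub_elt (u : free) : insub (elt u) = Some u.
Proof. exact: (valK u). Qed.

(** Completes free coordinates by the marked values; the default 0 is never reached, since every
    element is marked or free. *)
Definition point_of (y : {ffun free -> R}) (q : P) : R :=
  if [pick j | p j == q] is Some j then lam j
  else if insub q is Some u then y u else 0.

Lemma point_of_mark y j : point_of y (p j) = lam j.
Proof.
rewrite /point_of; case: pickP => [i /eqP /Hinj -> //|/(_ j)].
by rewrite eqxx.
Qed.

Lemma pick_free (u : free) : [pick j | p j == elt u] = None.
Proof.
case: pickP => // j /eqP pj; case/negP: (eltP u).
by rewrite -pj; apply: imset_f.
Qed.

Lemma point_of_free y (u : free) : point_of y (elt u) = y u.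
Proof. by rewrite /point_of pick_free insub_elt. Qed.

Lemma marked_or_free (q : P) : (exists j, q = p j) \/ (exists u : free, q = elt u).
Proof.
case: (boolP (q \in marked_set p)) => [/imsetP[j _ ->]|qA]; first by left; exists j.
by right; exists (Sub q qA).
Qed.

Section Grid.

Variable N : nat.

(* With [e = 2] consecutive elements of the chain are spread apart, so that
   cubes whose coordinates are sorted only up to an error of 1 are reached. *)
Definition decode (m : nat) (e : Z) (f : {ffun P -> 'I_K.+1 * 'I_m.+1}) : {ffun free -> Z} :=
  [ffun u => (grid_floor N (f (elt u)).1 - Z.of_nat (f (elt u)).2 +
              e * Z.of_nat #|[set r | slot_lt (f r) (f (elt u))]|)%Z].

(** * Cubes inside the polytope *)

Section Inner.

Variables (m : nat) (f : {ffun P -> 'I_K.+1 * 'I_m.+1}).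
Hypothesis fp : f \in placements ord p m (fun i => (grid_gap N i).-1).

(** Offsets from 1 to the gap minus 1 keep the scaled cube between [grid_floor N b + 1] and the
    floor of its block, hence between the two scaled marked values despite rounding. *)
Lemma decode_inner_bounds (u : free) :
  exists b : 'I_K.+1, [/\ b = (f (elt u)).1.+1 :> nat,
    (grid_floor N b + 1 <= decode 0 f u)%Z &
    (decode 0 f u + 1 <= grid_floor N (f (elt u)).1)%Z].
Proof.
have /placementsP[_ _ _ /(_ _ (eltP u))] := fp.
have := free_block Hpo Hmin fp (eltP u).
have -> : decode 0 f u = (grid_floor N (f (elt u)).1 - Z.of_nat (f (elt u)).2)%Z.
  by rewrite ffunE; lia.
case: (f (elt u)) => j s /= jK lim.
have := @grid_gapE N (Ordinal jK); rewrite /= inord_val => gapE.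
by exists (inord j.+1); split; [rewrite inordK|lia|lia].
Qed.

End Inner.

Lemma decode_inner_inj (m : nat) (f f' : {ffun P -> 'I_K.+1 * 'I_m.+1}) :
  f \in placements ord p m (fun i => (grid_gap N i).-1) ->
  f' \in placements ord p m (fun i => (grid_gap N i).-1) ->
  decode 0 f = decode 0 f' -> f = f'.
Proof.
move=> fp fp' eq_ff'; apply/ffunP => q.
have /placementsP[_ _ mark _] := fp.
have /placementsP[_ _ mark' _] := fp'.
case: (marked_or_free q) => [[j ->]|[u ->]]; first by rewrite mark mark'.
have [b [bE lo hi]] := decode_inner_bounds fp u.
have [b' [bE' lo' hi']] := decode_inner_bounds fp' u.
rewrite -eq_ff' in lo' hi'.
(* Different blocks decode into disjoint integer ranges, so the corner determines the block and then
   the offset. *)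
have eq1 : (f (elt u)).1 = (f' (elt u)).1.
  case: (ltngtP (f (elt u)).1 (f' (elt u)).1) => [lt_b|lt_b|]; last exact: val_inj.
    have := @grid_floor_mono N b (f' (elt u)).1; rewrite bE => /(_ lt_b); lia.
  have := @grid_floor_mono N b' (f (elt u)).1; rewrite bE' => /(_ lt_b); lia.
have := congr1 (fun z : {ffun free -> Z} => z u) eq_ff'; rewrite !ffunE eq1 => eq2.
rewrite [LHS]surjective_pairing [RHS]surjective_pairing eq1; congr pair.
by apply: ord_inj; lia.
Qed.

(** For [q] below [r], the slot of [r] comes first. In different blocks a marked value separates the
    coordinates ([up] and [down]); in the same block the corners differ by at least 1, so the unit
    intervals do not overlap in their interiors. *)
Lemma decode_inner_cube (m : nat) (f : {ffun P -> 'I_K.+1 * 'I_m.+1}) y :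
  (0 < N)%N -> f \in placements ord p m (fun i => (grid_gap N i).-1) ->
  cube N (decode 0 f) y -> Otilde ord p lam y.
Proof.
move=> N0 fp yc; have /placementsP[_ anti mark free] := fp.
have Npos : 0 < INR N by apply: lt_0_INR; apply/ltP.
have flo j : IZR (grid_floor N j) <= INR N * lam j.
  by have := Int_part_bounds (INR N * lam j); rewrite /grid_floor; lra.
have fhi j : INR N * lam j < IZR (grid_floor N j) + 1.
  by have := Int_part_bounds (INR N * lam j); rewrite /grid_floor; lra.
have up q : point_of y q <= lam (f q).1.
  case: (marked_or_free q) => [[j ->]|[u ->]].
    by rewrite point_of_mark mark /=; lra.
  have [b [bE lo hi]] := decode_inner_bounds fp u.
  rewrite point_of_free; apply: (Rmult_le_reg_l (INR N)) => //.
  have := cube_scale u N0 yc; have := flo (f (elt u)).1.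
  by have := IZR_le _ _ hi; rewrite plus_IZR; lra.
have down q (c : 'I_K.+1) : ((f q).1 < c)%N -> lam c <= point_of y q.
  case: (marked_or_free q) => [[j ->]|[u ->]].
    by rewrite point_of_mark mark /= => jc; apply: Hdec; apply: ltnW.
  have [b [bE lo hi]] := decode_inner_bounds fp u.
  rewrite -bE => /Hdec cb; apply: Rle_trans cb _.
  rewrite point_of_free; apply: (Rmult_le_reg_l (INR N)) => //.
  have := cube_scale u N0 yc; have := fhi b.
  by have := IZR_le _ _ lo; rewrite plus_IZR; lra.
exists (point_of y); split; first exact: point_of_mark.
split; first by move=> q h; rewrite -(point_of_free y (exist _ q h)).
move=> q r /anti /orP[lt_rq|/andP[/eqP eq1 lt2]].
  exact: Rle_trans (up q) (down r _ lt_rq).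
case: (marked_or_free r) eq1 lt2 => [[j ->]|[u ->]].
  by rewrite mark /= => -> _; rewrite point_of_mark; apply: up.
case: (marked_or_free q) => [[j ->]|[v ->]]; first by rewrite mark ltn0.
move=> eq1 lt2; rewrite !point_of_free; apply: (Rmult_le_reg_l (INR N)) => //.
have := cube_scale u N0 yc; have := cube_scale v N0 yc.
have : (decode 0 f v + 1 <= decode 0 f u)%Z by rewrite !ffunE eq1; lia.
by move/IZR_le; rewrite plus_IZR; lra.
Qed.

(** * Cubes meeting the polytope, with [bf] sorting [P] by decreasing coordinate *)

Section Outer.

Variables (x : P -> R) (z : {ffun free -> Z}) (bf : rel P).
Hypothesis bf_total : strict_total bf.
Hypothesis bf_ord : forall q r, poset_lt ord q r -> bf r q.
Hypothesis bf_mark : forall i j, bf (p i) (p j) = (i < j)%N.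
Hypothesis bf_le : forall q r, bf r q -> x q <= x r.
Hypothesis x_mark : forall j, x (p j) = lam j.
Hypothesis x_cube : forall u, IZR (z u) <= INR N * x (elt u) <= IZR (z u) + 1.

Let bf_irr : irreflexive bf. Proof. by case: bf_total. Qed.
Let bf_trans : transitive bf. Proof. by case: bf_total. Qed.

Definition marks_before (q : P) : nat := #|[set j | bf (p j) q]|.

(** Since [bf] orders the marks by label, those before [q] form an initial segment. A free [q]
    therefore belongs to block [(marks_before q).-1]. *)
Lemma marks_beforeE q j : bf (p j) q = (j < marks_before q)%N.
Proof.
rewrite -mem_downset ?inE // => i k; rewrite !inE leq_eqVlt => /orP[/eqP/val_inj -> //|].
by rewrite -bf_mark; apply: bf_trans.
Qed.

(** A free element has a mark above it, which precedes it in [bf], and a mark below it, which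
    follows it. *)
Lemma marks_before_free u : (0 < marks_before (elt u) <= K)%N.
Proof.
have uA j : elt u != p j by apply: contraNneq (eltP u) => ->; apply: imset_f.
apply/andP; split.
  have [j uj] := marked_above (elt u) Hpo Hmax.
  by have := bf_ord (q := elt u) (r := p j); rewrite /poset_lt uj uA marks_beforeE; lia.
have [j ju] := marked_below (elt u) Hpo Hmin.
have uj : bf (elt u) (p j) by apply: bf_ord; rewrite /poset_lt ju eq_sym uA.
rewrite leqNgt; apply/negP => bK; have : bf (p j) (elt u).
  by rewrite marks_beforeE; apply: leq_trans bK.
by move/bf_trans/(_ uj); rewrite bf_irr.
Qed.

(** Obtained by solving the formula of [decode 2] for the offset, with the rank taken in [bf]. *)
Definition offset (u : free) : nat :=
  Z.to_nat (grid_floor N (inord (marks_before (elt u)).-1) - z u +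
            2 * Z.of_nat #|[set r | bf r (elt u)]|).

(** The coordinate lies between two consecutive marked values, so the block floor minus [z u] is
    between 0 and the gap plus 1. Adding twice a rank between 1 and [#|P|] gives both bounds and the
    slack [(2 * #|P|).+1]. *)
Lemma offset_bounds u :
  Z.of_nat (offset u) = (grid_floor N (inord (marks_before (elt u)).-1) - z u +
    2 * Z.of_nat #|[set r | bf r (elt u)]|)%Z /\
  (0 < offset u <= grid_gap N (marks_before (elt u)).-1 + (2 * #|P|).+1)%N.
Proof.
have /andP[b0 bK] := marks_before_free u.
have b1K : ((marks_before (elt u)).-1 < K)%N by rewrite prednK.
have lo_mark : bf (p (inord (marks_before (elt u)).-1)) (elt u).
  by rewrite marks_beforeE inordK; lia.
have hi_mark : bf (elt u) (p (inord (marks_before (elt u)).-1.+1)).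
  have := marks_beforeE (elt u) (inord (marks_before (elt u)).-1.+1).
  rewrite inordK ?ltnS // prednK // ltnn.
  have [_ _ tot] := bf_total.
  have /tot : p (inord (marks_before (elt u))) != elt u.
    by apply: contraNneq (eltP u) => <-; apply: imset_f.
  by case/orP => ->.
have zle : (z u <= grid_floor N (inord (marks_before (elt u)).-1))%Z.
  apply: le_Int_part; apply: Rle_trans (proj1 (x_cube u)) _.
  by apply: Rmult_le_compat_l; [exact: pos_INR|rewrite -x_mark; apply: bf_le].
have zge : (grid_floor N (inord (marks_before (elt u)).-1.+1) <= z u + 1)%Z.
  apply: le_IZR; rewrite plus_IZR; apply: Rle_trans (proj2 (x_cube u)).
  apply: Rle_trans (proj1 (Int_part_bounds _)) _.
  by apply: Rmult_le_compat_l; [exact: pos_INR|rewrite -x_mark; apply: bf_le].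
(* The mark opening the block precedes [u], so the rank is positive; this keeps the offset off the
   reserved value 0. *)
have s0 : (0 < #|[set r | bf r (elt u)]|)%N.
  by apply/card_gt0P; exists (p (inord (marks_before (elt u)).-1)); rewrite inE.
have sn : (#|[set r | bf r (elt u)]| <= #|P|)%N by apply: max_card.
have := @grid_gapE N (Ordinal b1K) => /= gapE.
have offE : Z.of_nat (offset u) = (grid_floor N (inord (marks_before (elt u)).-1) - z u +
    2 * Z.of_nat #|[set r | bf r (elt u)]|)%Z by rewrite /offset Z2Nat.id //; lia.
split=> //; move: zle zge s0 sn gapE offE.
move: (offset u) #|[set r | bf r (elt u)]| #|P| (z u) (grid_gap _ _).
move: (grid_floor _ (inord _.+1)) (grid_floor _ _) => t' t o s n zu d; lia.
Qed.

Variable m : nat.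
Hypothesis gap_m : forall i : 'I_K, (grid_gap N i + (2 * #|P|).+1 <= m)%N.

Definition outer_placement : {ffun P -> 'I_K.+1 * 'I_m.+1} :=
  [ffun q => if [pick j | p j == q] is Some j then (j, ord0)
             else if insub q is Some u
                  then (inord (marks_before q).-1, inord (offset u)) else (ord0, ord0)].

Lemma outer_placement_mark j : outer_placement (p j) = (j, ord0).
Proof.
rewrite ffunE; case: pickP => [i /eqP /Hinj -> //|/(_ j)].
by rewrite eqxx.
Qed.

Lemma outer_placement_free u :
  (outer_placement (elt u)).1 = inord (marks_before (elt u)).-1 /\
  (outer_placement (elt u)).1 = (marks_before (elt u)).-1 :> nat /\
  (outer_placement (elt u)).2 = offset u :> nat.
Proof.
have /andP[b0 bK] := marks_before_free u.
have b1K : ((marks_before (elt u)).-1 < K)%N by rewrite prednK.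
have [_ /andP[_ off]] := offset_bounds u.
have offm : (offset u <= m)%N := leq_trans off (gap_m (Ordinal b1K)).
rewrite ffunE pick_free insub_elt /=; split=> //.
by rewrite !inordK ?ltnS // ltnW.
Qed.

Lemma outer_placement_anti q r : bf r q -> slot_lt (outer_placement r) (outer_placement q).
Proof.
rewrite /slot_lt.
case: (marked_or_free q) => [[i ->]|[v ->]]; case: (marked_or_free r) => [[j ->]|[u ->]].
- by rewrite !outer_placement_mark /= bf_mark => ->.
- rewrite outer_placement_mark /= => ui.
  have [_ [-> _]] := outer_placement_free u; apply/orP; left.
  have /andP[b0 bK] := marks_before_free u; rewrite prednK // leqNgt -marks_beforeE.
  by apply/negP => /bf_trans/(_ ui); rewrite bf_irr.
- rewrite outer_placement_mark /= marks_beforeE => jv.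
  have [_ [e1 ->]] := outer_placement_free v; have [_ /andP[-> _]] := offset_bounds v.
  by rewrite andbT -val_eqE /= e1; lia.
move=> uv; have [fu [fu1 ->]] := outer_placement_free u.
have [fv [fv1 ->]] := outer_placement_free v.
have bb : (marks_before (elt u) <= marks_before (elt v))%N.
  apply: subset_leq_card; apply/subsetP => j; rewrite !inE => ju; exact: bf_trans ju uv.
have /andP[bu0 _] := marks_before_free u.
rewrite fu1 fv1 -val_eqE /= fu1 fv1.
move: bb; rewrite leq_eqVlt => /orP[/eqP bb|]; last by lia.
rewrite bb ltnn eqxx /=.
have [ou _] := offset_bounds u; have [ov _] := offset_bounds v.
have st : (#|[set r | bf r (elt u)]| < #|[set r | bf r (elt v)]|)%N.
  apply: proper_card; apply/properP; split.
    by apply/subsetP => w; rewrite !inE => /bf_trans; apply.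
  by exists (elt u); rewrite !inE ?uv ?bf_irr.
(* In sorted order corners can rise by at most 1, while twice the rank rises by at least 2, so the
   offset strictly increases. *)
have zz : (z v <= z u + 1)%Z.
  apply: le_IZR; rewrite plus_IZR.
  apply: Rle_trans (proj1 (x_cube v)) _; apply: Rle_trans (proj2 (x_cube u)).
  by apply: Rmult_le_compat_l; [exact: pos_INR|apply: bf_le].
rewrite bb in ou; move: (offset u) (offset v) ou ov => a b; lia.
Qed.

(** A strictly monotone map out of a total order reflects the order. Hence the rank read by [decode]
    is the one used in [offset]. *)
Lemma outer_placement_iff q r : slot_lt (outer_placement r) (outer_placement q) = bf r q.
Proof.
have [irr trans _] := slot_lt_total K m; have [_ _ tot] := bf_total.
apply/idP/idP; last exact: outer_placement_anti.
case: (eqVneq r q) => [->|/tot /orP[//|/outer_placement_anti qr /trans/(_ qr)]];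
  by rewrite irr.
Qed.

Lemma outer_placement_mem :
  outer_placement \in placements ord p m (fun i => grid_gap N i + (2 * #|P|).+1)%N.
Proof.
have [irr _ _] := slot_lt_total K m; have [_ _ tot] := bf_total.
apply/placementsP; split.
- move=> q r eq_qr; apply/eqP/negPn/negP => /tot; rewrite -!outer_placement_iff eq_qr irr.
  by [].
- by move=> q r /bf_ord/outer_placement_anti.
- exact: outer_placement_mark.
move=> q; case: (marked_or_free q) => [[j ->]|[u ->] _]; first by rewrite imset_f.
have [_ [-> ->]] := outer_placement_free u.
by have [_] := offset_bounds u.
Qed.

Lemma decode_outer : decode 2 outer_placement = z.
Proof.
apply/ffunP => u; rewrite ffunE.
have [-> [_ ->]] := outer_placement_free u; have [-> _] := offset_bounds u.
have -> : [set r | slot_lt (outer_placement r) (outer_placement (elt u))] =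
    [set r | bf r (elt u)] by apply/setP => r; rewrite !inE outer_placement_iff.
by lia.
Qed.

End Outer.
End Grid.
End Cubes.

(** * Breaking ties between equal coordinates *)

(** The key packs a lexicographic triple into one number: [w] orders the marks by label, the
    down-set size [d] makes the key strict along [ord], and the enumeration rank [e] makes it
    injective. The radices work because [d <= n] and [e < n]. *)
Lemma linear_key (P : finType) (ord : rel P) (K : nat) (p : 'I_K.+1 -> P) :
  is_partial_order ord -> injective p ->
  (forall i j : 'I_K.+1, poset_lt ord (p i) (p j) -> (j < i)%N) ->
  exists key : P -> nat, [/\ injective key,
    forall q r, poset_lt ord q r -> (key q < key r)%N &
    forall i j : 'I_K.+1, (i < j)%N -> (key (p j) < key (p i))%N].
Proof.
case=> refl [anti trans] Hinj Hlab.
pose w q := (\max_(j | ord (p j) q) (K - j))%N.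
have w_mark i : w (p i) = (K - i)%N.
  (* By [Hlab] a mark strictly below [p i] has a larger label, so the maximum is reached at [i]
     itself. *)
  apply/eqP; rewrite eqn_leq leq_bigmax_cond ?refl // andbT.
  apply/bigmax_leqP => j ji; apply: leq_sub2l.
  case: (eqVneq (p j) (p i)) => [pji|neq].
    by rewrite (Hinj _ _ pji).
  by apply/ltnW/Hlab; rewrite /poset_lt ji.
have w_mono q r : ord q r -> (w q <= w r)%N.
  move=> qr; apply/bigmax_leqP => j jq.
  by apply: leq_bigmax_cond; apply: trans jq qr.
pose n := #|P|; pose d q := #|[set r | ord r q]|.
have d_mono q r : poset_lt ord q r -> (d q < d r)%N.
  case/andP=> qr neq; apply: proper_card; apply/properP; split.
    by apply/subsetP => s; rewrite !inE => sq; apply: trans sq qr.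
  exists r; rewrite !inE ?refl //; apply: contraNN neq => rq.
  by apply/eqP/anti; rewrite qr.
have dn q : (d q <= n)%N by apply: max_card.
pose e (q : P) : nat := enum_rank q.
have en q : (e q < n)%N by apply: ltn_ord.
have lex q r : ((w q * n.+1 + d q) < (w r * n.+1 + d r) ->
    (w q * n.+1 + d q) * n + e q < (w r * n.+1 + d r) * n + e r)%N.
  move=> lt_qr; apply: (@leq_trans ((w q * n.+1 + d q).+1 * n)).
    by rewrite mulSn addnC ltn_add2r.
  by apply: (leq_trans (leq_mul lt_qr (leqnn n))); apply: leq_addr.
exists (fun q => (w q * n.+1 + d q) * n + e q)%N; split.
- move=> q r /(congr1 (modn^~ n)); rewrite !modnMDl !modn_small //.
  by move/val_inj/enum_rank_inj.
- move=> q r qr; apply: lex; have := d_mono q r qr.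
  case/andP: qr => /w_mono wqr _ dqr.
  by rewrite -addnS leq_add // leq_mul2r wqr orbT.
move=> i j ij; apply: lex; rewrite !w_mark.
have := dn (p j) => djn; have jK := ltn_ord j.
apply: (@leq_trans ((K - j).+1 * n.+1)).
  by rewrite mulSn addnC ltn_add2r ltnS.
apply: leq_trans (leq_addr _ _); rewrite leq_mul2r /=; lia.
Qed.

(* Ties between coordinates are broken by a fixed linear extension of [ord] in
   which the marked elements occur in the order of their labels. *)
Lemma before_exists (P : finType) (ord : rel P) (K : nat)
    (p : 'I_K.+1 -> P) (lam : 'I_K.+1 -> R) (x : P -> R) :
  is_partial_order ord -> injective p ->
  (forall i j : 'I_K.+1, (i <= j)%N -> lam j <= lam i) ->
  (forall i j : 'I_K.+1, poset_lt ord (p i) (p j) -> (j < i)%N) ->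
  (forall i, x (p i) = lam i) ->
  (forall q r, poset_lt ord q r -> x q <= x r) ->
  exists bf : rel P, [/\ strict_total bf,
    forall q r, poset_lt ord q r -> bf r q,
    forall i j, bf (p i) (p j) = (i < j)%N &
    forall q r, bf r q -> x q <= x r].
Proof.
move=> Hpo Hinj Hdec Hlab x_mark x_mono.
have [key [key_inj key_ord key_mark]] := linear_key Hpo Hinj Hlab.
pose bf r q := if Rlt_dec (x q) (x r) then true
               else if Rlt_dec (x r) (x q) then false else (key q < key r)%N.
have bfP r q : bf r q <-> x q < x r \/ x q = x r /\ (key q < key r)%N.
  rewrite /bf; case: Rlt_dec => [lt|nlt]; first by split=> // _; left.
  case: Rlt_dec => [lt|nlt']; first by split=> // -[|[]] //; lra.
  by split=> [?|[|[]] //]; right; split=> //; lra.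
have irr : irreflexive bf.
  by move=> q; apply/negP => /bfP[|[_]]; [lra|rewrite ltnn].
have tr : transitive bf.
  move=> r q s /bfP[?|[? k1]] /bfP[?|[? k2]]; apply/bfP; try (left; lra).
  by right; split; [lra|apply: ltn_trans k2 k1].
have mark (i j : 'I_K.+1) : (i < j)%N -> bf (p i) (p j).
  move=> ij; apply/bfP; rewrite !x_mark; have := Hdec i j (ltnW ij).
  by case=> [|->]; [left|right; split=> //; apply: key_mark].
exists bf; split.
- split=> // q r neq.
  case: (Rtotal_order (x q) (x r)) => [lt|[eq|lt]]; apply/orP.
  + by right; apply/bfP; left.
  + have : key q != key r by apply: contraNneq neq => /key_inj ->.
    by rewrite neq_ltn => /orP[k|k]; [right|left]; apply/bfP; right.
  + by left; apply/bfP; left.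
- move=> q r qr; apply/bfP; case: (x_mono _ _ qr) => [|eq]; [by left|right].
  by split=> //; apply: key_ord.
- move=> i j; case: (ltngtP i j) => [/mark //|ji|/val_inj ->]; last exact: irr.
  by apply/negP => /tr/(_ (mark _ _ ji)); rewrite irr.
by move=> q r /bfP; lra.
Qed.

(** * Assembling the Jordan content *)

Theorem theorem3p4 (P : finType) (ord : rel P) (K : nat)
  (p : 'I_K.+1 -> P) (lam : 'I_K.+1 -> R)
  (Hpo : is_partial_order ord)
  (Hinj : injective p)
  (Hmin : forall q : P, (forall r, ord r q -> r = q) -> q \in marked_set p)
  (Hmax : forall q : P, (forall r, ord q r -> r = q) -> q \in marked_set p)
  (Hmono : forall i j, ord (p i) (p j) -> Rle (lam i) (lam j))
  (Hdec : forall i j : 'I_K.+1, (i <= j)%N -> Rle (lam j) (lam i))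
  (Hlab : forall i j : 'I_K.+1, poset_lt ord (p i) (p j) -> (j < i)%N) :
  jordan_content (Otilde ord p lam) (rhs_sum ord p lam).
Proof.
pose c := (2 * #|P|).+1.
pose m N := gap_bound lam N c.
have gap_m N (i : 'I_K) : (grid_gap lam N i + c <= m N)%N by apply: gap_bound_ge.
pose Min N i := (grid_gap lam N i).-1.
pose Mout N i := (grid_gap lam N i + c)%N.
have cvin : Un_cv (fun N => INR #|placements ord p (m N) (Min N)| /
    INR N ^ #|free_coords (marked_set p)|) (rhs_sum ord p lam).
  (* Rounding costs 1 and the predecessor at most 1 more. *)
  apply: (@card_placements_limit _ _ _ _ _ _ _ 2) => // N i.
    by have := gap_m N i; rewrite /Min; lia.
  have := grid_gap_bounds Hdec N i; rewrite /Min.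
  by case: (grid_gap lam N i) => [|g]; rewrite ?S_INR /=; lra.
have cvout : Un_cv (fun N => INR #|placements ord p (m N) (Mout N)| /
    INR N ^ #|free_coords (marked_set p)|) (rhs_sum ord p lam).
  apply: (@card_placements_limit _ _ _ _ _ _ _ (1 + INR c)) => // N i.
  have := grid_gap_bounds Hdec N i; have := pos_INR c; rewrite /Mout plus_INR; lra.
move=> eps eps0.
have [N1 HN1] := cvin eps eps0; have [N2 HN2] := cvout eps eps0.
exists (maxn N1 N2) => N; rewrite geq_max => /andP[N1N N2N] N0.
have {HN1} /Rabs_def2[_ in_ge] := HN1 N (leP N1N).
have {HN2} /Rabs_def2[out_le _] := HN2 N (leP N2N).
have [Lout [nd [sub len]]] := NoDup_subcover
  (List.map (@decode P K p lam N (m N) 2) (enum (placements ord p (m N) (Mout N)))).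
exists (List.map (@decode P K p lam N (m N) 0) (enum (placements ord p (m N) (Min N)))), Lout.
split.
  apply: NoDup_map_uniq (enum_uniq _) _ => f f'; rewrite !mem_enum.
  exact: (decode_inner_inj Hpo Hmin Hdec).
split=> //; split.
  move=> z /List.in_map_iff[f [<- /mem_In]]; rewrite mem_enum => fp y yc.
  exact: (decode_inner_cube Hpo Hinj Hmin Hdec N0 fp yc).
split.
  move=> z [y [yc [x [x_mark [x_free x_mono]]]]]; apply: sub.
  have [bf [bf_total bf_ord bf_mark bf_le]] := before_exists Hpo Hinj Hdec Hlab x_mark x_mono.
  have x_cube u : IZR (z u) <= INR N * x (elt u) <= IZR (z u) + 1.
    have := cube_scale u N0 yc; rewrite (x_free (elt u) (eltP u)).
    (* The index rebuilt from [elt u] and its membership proof has the same value as [u], so it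
       equals [u]. *)
    by congr (_ <= _ * y _ <= _); apply: val_inj.
  apply/List.in_map_iff; exists (outer_placement lam N z bf (m N)); split.
    by apply: (decode_outer Hpo Hinj Hmin Hmax Hdec) => //; exact: bf_le.
  apply: In_mem; rewrite mem_enum.
  by apply: (outer_placement_mem Hpo Hinj Hmin Hmax Hdec) => //; exact: bf_le.
have len_enum (T : finType) (U : Type) (h : T -> U) (A : {set T}) :
  List.length (List.map h (enum A)) = #|A| by rewrite List.length_map cardE.
have in_le : rhs_sum ord p lam - eps <= INR #|placements ord p (m N) (Min N)| /
    INR N ^ #|free_coords (marked_set p)| by lra.
split; first by rewrite len_enum.
apply: Rle_trans (_ : INR #|placements ord p (m N) (Mout N)| /
    INR N ^ #|free_coords (marked_set p)| <= _); last by lra.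
apply: Rmult_le_compat_r.
  by apply/Rlt_le/Rinv_0_lt_compat/pow_lt/lt_0_INR/ltP.
by apply: le_INR; apply/leP; rewrite -(len_enum _ _ (@decode P K p lam N (m N) 2)).
Qed.
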